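(* Let $x \geq 0$ be a real number and let $p$ and $q$ be positive integers with $\gcd(p,q)=1$. For each positive integer $n$ and real $y$, let $B_n(y) = \sum_{k=1}^n \frac1k \left\lfloor \frac{k}{n}y \right\rfloor$. Then $$\lim_{n \to \infty} \left(B_n\left(x + \tfrac{p}{q}n\right) - B_n\left(\tfrac{p}{q} n\right) \right) = \frac{1}{q} \sum_{k = 1}^{\lfloor qx \rfloor} \log\left(\frac{q x}{k}\right).$$
   Context: $\lfloor t \rfloor$ denotes the greatest integer less than or equal to $t$, and $\log$ is the natural logarithm. An empty sum equals $0$. *)

(* Defs.v *)
From HB Require Import structures.
From mathcomp Require Import all_boot all_order all_algebra.
From mathcomp Require Import all_classical all_reals all_analysis.

Set Implicit Arguments.
Unset Strict Implicit.
Unset Printing Implicit Defensive.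

Import Order.TTheory GRing.Theory Num.Theory.
Import numFieldNormedType.Exports.

Local Open Scope classical_set_scope.
Local Open Scope ring_scope.

(* The junk value at n = 0 is the empty sum, which does not affect limits. *)
Definition B (R : realType) (n : nat) (y : R) : R :=
  \sum_(1 <= k < n.+1) (k%:R)^-1 * (Num.floor (k%:R / n%:R * y))%:~R.

(* Main.v *)
Require Import Defs.
From HB Require Import structures.
From mathcomp Require Import all_boot all_order all_algebra.
From mathcomp Require Import all_classical all_reals all_analysis.
From mathcomp Require Import zify ring lra.

Set Implicit Arguments.
Unset Strict Implicit.
Unset Printing Implicit Defensive.

Import Order.TTheory GRing.Theory Num.Theory.
Import numFieldNormedType.Exports.

Local Open Scope classical_set_scope.
Local Open Scope ring_scope.

(** Why the limit holds.  With t = q x k / n, the k-th term of the difference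
    is 1/k times floor((k p + t) / q) - floor(k p / q), and such a jump of
    floor( . / q) counts the integers l in [1, t] such that q divides k p + l
    ([floor_jump]).  Since k <= n, every such l is at most floor(q x), a bound
    that depends neither on k nor on n; exchanging the two sums therefore
    gives a sum over a fixed finite set of l ([B_diff]):

      sum over 1 <= l <= floor(q x) of the sum of 1/k over the k <= n
      such that q | k p + l and k >= n / (q x / l).

    Because p is invertible modulo q, the condition q | k p + l says that k
    lies in one residue class modulo q ([class_of_congruence]).  The sum of
    1/k over the members k of a residue class in [n / lam, n] tends to
    (ln lam) / q ([cvg_class_sum]), and taking lam = q x / l and summing over
    l gives the theorem.

    For that last limit, q/k lies between ln(k + q) - ln k and
    ln k - ln(k - q).  Along a residue class these differences telescope
    ([telescope_class]), so that the sum is trapped between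
    (ln n - ln(n / lam + q)) / q and (ln n - ln(n / lam - q)) / q, and both
    bounds tend to (ln lam) / q. *)

(** The residue class is always that of - a, written as q | k + a, so that no
    subtraction on natural numbers enters the membership condition.  For
    n >= q - 1 this is the largest member of the class that is at most n. *)
Definition class_floor (q a n : nat) : nat := n - (n + a) %% q.

Lemma class_floor_bounds (q a n : nat) : (0 < q)%N ->
  (n < class_floor q a n + q)%N /\ (class_floor q a n <= n)%N.
Proof. by move=> q0; have := ltn_pmod (n + a) q0; rewrite /class_floor; lia. Qed.

(** Passing from n to n + 1 changes [class_floor q a] only when n + 1 is in the
    class; it then moves from n + 1 - q to n + 1, which is the summand.  The
    condition q <= m keeps the subtractions k - q and in [class_floor] from
    being truncated at 0. *)
Lemma telescope_class (V : zmodType) (G : nat -> V) (q a m n : nat) :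
  (0 < q)%N -> (q <= m)%N -> (m <= n)%N ->
  \sum_(m.+1 <= k < n.+1 | (q %| k + a)%N) (G k - G (k - q)%N)
  = G (class_floor q a n) - G (class_floor q a m).
Proof.
move=> q0 qm; elim: n => [|n IHn] mn; first by lia.
have [{}mn|nm] := leqP m n; last first.
  have -> : m = n.+1 by lia.
  by rewrite big_geq// subrr.
rewrite big_mkcond big_nat_recr //= -big_mkcond /= IHn//.
rewrite /class_floor addSn modnS; case: ifPn => [dv|_]; last first.
  by rewrite subSS addr0.
have -> : (n - (n + a) %% q = n.+1 - q)%N.
  case/dvdnP: dv => -[|c] e; first by lia.
  have -> : (n + a = c * q + q.-1)%N by lia.
  by rewrite modnMDl modn_small; lia.
by rewrite subn0 addrC addrA subrK.
Qed.

Section RealSums.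
Variable R : realType.

(** This and [ln_le_inv] are the integral bounds for 1/k over a step of
    length q, obtained here from ln(1 + y) <= y at y = - q/k and y = q/k. *)
Lemma inv_le_ln (q k : nat) : (0 < q)%N -> (q < k)%N ->
  k%:R^-1 <= q%:R^-1 * (ln k%:R - ln (k - q)%N%:R) :> R.
Proof.
move=> q0 qk; have qR : 0 < q%:R :> R by rewrite ltr0n.
have kR : 0 < k%:R :> R by rewrite ltr0n; lia.
have dR : 0 < (k - q)%N%:R :> R by rewrite ltr0n; lia.
have dE : (k - q)%N%:R = k%:R - q%:R :> R by rewrite natrB// ltnW.
have e : 1 + - (q%:R / k%:R) = (k - q)%N%:R / k%:R :> R.
  by rewrite dE; field; lra.
have : ln (1 + - (q%:R / k%:R)) <= - (q%:R / k%:R) :> R.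
  by apply: le_ln1Dx; rewrite ltrN2 ltr_pdivrMr// mul1r ltr_nat.
rewrite e ln_div ?posrE// => h.
rewrite mulrC ler_pdivlMr//; lra.
Qed.

Lemma ln_le_inv (q k : nat) : (0 < q)%N -> (0 < k)%N ->
  q%:R^-1 * (ln (k + q)%N%:R - ln k%:R) <= k%:R^-1 :> R.
Proof.
move=> q0 k0; have qR : 0 < q%:R :> R by rewrite ltr0n.
have kR : 0 < k%:R :> R by rewrite ltr0n.
have dR : 0 < (k + q)%N%:R :> R by rewrite ltr0n; lia.
have e : 1 + q%:R / k%:R = (k + q)%N%:R / k%:R :> R.
  by rewrite natrD; field; lra.
have : ln (1 + q%:R / k%:R) <= q%:R / k%:R :> R.
  by apply: le_ln1Dx; apply: lt_trans (divr_gt0 qR kR); lra.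
rewrite e ln_div ?posrE// => h.
rewrite mulrC ler_pdivrMr//; lra.
Qed.

(** The sum is bounded by the telescoping sum for G = ln; [class_floor] is
    then replaced by its extreme values, n and m + 1 - q. *)
Lemma class_sum_le (q a m n : nat) : (0 < q)%N -> (q <= m)%N -> (m <= n)%N ->
  \sum_(m.+1 <= k < n.+1 | (q %| k + a)%N) k%:R^-1
  <= q%:R^-1 * (ln n%:R - ln (m.+1 - q)%N%:R) :> R.
Proof.
move=> q0 qm mn.
have [hn1 hn2] := class_floor_bounds a n q0.
have [hm1 hm2] := class_floor_bounds a m q0.
apply: (@le_trans _ _ (q%:R^-1 * (ln (class_floor q a n)%:R
                                  - ln (class_floor q a m)%:R))).
  rewrite -(@telescope_class _ (fun k => ln k%:R) q a m n)// mulr_sumr.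
  rewrite big_nat_cond [leRHS]big_nat_cond; apply: ler_sum => k /andP[hk _].
  by apply: inv_le_ln; lia.
have h u v : (0 < u)%N -> (u <= v)%N -> ln u%:R <= ln v%:R :> R.
  by move=> u0 uv; rewrite ler_ln ?posrE ?ltr0n ?ler_nat//; lia.
rewrite ler_wpM2l ?invr_ge0// lerB//; apply: h; lia.
Qed.

(** The lower bound telescopes with G k = ln(k + q), for which
    G k - G (k - q) = ln(k + q) - ln k. *)
Lemma class_sum_ge (q a m n : nat) : (0 < q)%N -> (q <= m)%N -> (m <= n)%N ->
  q%:R^-1 * (ln n%:R - ln (m + q)%N%:R)
  <= \sum_(m.+1 <= k < n.+1 | (q %| k + a)%N) k%:R^-1 :> R.
Proof.
move=> q0 qm mn.
have [hn1 hn2] := class_floor_bounds a n q0.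
have [hm1 hm2] := class_floor_bounds a m q0.
apply: (@le_trans _ _ (q%:R^-1 * (ln (class_floor q a n + q)%N%:R
                                  - ln (class_floor q a m + q)%N%:R))).
  have h u v : (0 < u)%N -> (u <= v)%N -> ln u%:R <= ln v%:R :> R.
    by move=> u0 uv; rewrite ler_ln ?posrE ?ltr0n ?ler_nat//; lia.
  rewrite ler_wpM2l ?invr_ge0// lerB//; apply: h; lia.
rewrite -(@telescope_class _ (fun k => ln (k + q)%N%:R) q a m n)// mulr_sumr.
rewrite big_nat_cond [leRHS]big_nat_cond; apply: ler_sum => k /andP[hk _].
by rewrite subnK; [apply: ln_le_inv; lia | lia].
Qed.

(** Both squeezing bounds have this form, with c = 1/lam and d = q or - q: the
    shift d becomes negligible, as (n c + d) / n = c + d/n tends to c. *)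
Lemma cvg_ln_ratio (c d : R) : 0 < c ->
  (fun n : nat => ln n%:R - ln (n%:R * c + d)) @ \oo --> - ln c.
Proof.
move=> c0.
have H : (fun n : nat => - ln (c + d * (n%:R)^-1)) @ \oo --> - ln c.
  apply: cvgN; apply: (@cvg_comp _ _ _ (fun n : nat => c + d * n%:R^-1) (@ln R)
    \oo (nbhs c)); last exact: continuous_ln.
  have {2}-> : c = c + d * 0 by rewrite mulr0 addr0.
  apply: cvgD; first exact: cvg_cst.
  apply: cvgM; first exact: cvg_cst.
  apply/gtr0_cvgV0; last exact: cvgr_idn.
  by near=> n; rewrite ltr0n; near: n; exact: nbhs_infty_gt.
apply: cvg_trans H; apply: near_eq_cvg; near=> n.
have n0 : 0 < n%:R :> R by rewrite ltr0n; near: n; exact: nbhs_infty_gt.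
have nd : 0 < n%:R * c + d.
  rewrite -ltrBlDr sub0r -ltr_pdivrMr//; near: n; exact: nbhs_infty_gtr.
have -> : c + d * n%:R^-1 = (n%:R * c + d) / n%:R by field; lra.
by rewrite ln_div ?posrE//; lra.
Unshelve. all: by end_near. Qed.

(** The condition n <= lam k cuts the sum off at the least k with
    k >= n / lam; calling it m + 1 gives m < n / lam <= m + 1, so [class_sum_le]
    and [class_sum_ge] squeeze the sum. *)
Lemma cvg_class_sum (q a : nat) (lam : R) : (0 < q)%N -> 1 <= lam ->
  (fun n : nat => \sum_(1 <= k < n.+1 | (q %| k + a)%N && (n%:R <= lam * k%:R))
                    k%:R^-1) @ \oo --> q%:R^-1 * ln lam.
Proof.
move=> q0 lam1.
have l0 : 0 < lam by lra.
have il0 : 0 < lam^-1 by rewrite invr_gt0.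
have lnE : ln lam = - ln lam^-1 by rewrite lnV ?posrE// opprK.
apply: (@squeeze_cvgr _ _ _ _
  (fun n : nat => q%:R^-1 * (ln n%:R - ln (n%:R * lam^-1 + q%:R)))
  (fun n : nat => q%:R^-1 * (ln n%:R - ln (n%:R * lam^-1 + - q%:R)))); last first.
- by rewrite lnE; apply: cvgM; [exact: cvg_cst | exact: cvg_ln_ratio].
- by rewrite lnE; apply: cvgM; [exact: cvg_cst | exact: cvg_ln_ratio].
near=> n.
(* This makes n / lam > q + 1, hence m >= q. *)
have nq : (q%:R + 1) * lam < n%:R by near: n; exact: nbhs_infty_gtr.
have ex : exists k : nat, n%:R <= lam * k%:R.
  by exists n; rewrite ler_peMl.
case: (ex_minnP ex) => [[|m]] hm hmin.
  have : 0 <= q%:R :> R by [].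
  nra.
have mlt : m%:R < n%:R * lam^-1.
  rewrite ltr_pdivlMr// mulrC ltNge; apply/negP => /hmin; lia.
have mge : n%:R * lam^-1 <= m.+1%:R by rewrite ler_pdivrMr// mulrC.
have nq' : q%:R + 1 < n%:R * lam^-1 by rewrite ltr_pdivlMr.
have qm : (q <= m)%N.
  by rewrite -ltnS -(ltr_nat R); lra.
have mn : (m <= n)%N.
  by apply: ltnW; apply: hmin; rewrite ler_peMl.
rewrite (_ : \sum_(1 <= k < n.+1 | _) _ =
    \sum_(m.+1 <= k < n.+1 | (q %| k + a)%N) k%:R^-1); last first.
  rewrite [RHS](@big_nat_widenl _ _ _ _ 1%N)//.
  apply: eq_bigl => k; congr (_ && _).
  apply/idP/idP => [/hmin//|mk].
  by apply: le_trans hm _; rewrite ler_pM2l// ler_nat.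
apply/andP; split.
  apply: le_trans (class_sum_ge a q0 qm mn).
  rewrite ler_wpM2l ?invr_ge0// lerB// ler_ln ?posrE ?natrD.
  - by rewrite lerD2r ltW.
  - by apply: ltr_wpDl; rewrite ?ltr0n.
  - by apply: ltr_wpDl; rewrite ?ltr0n// mulr_ge0// ltW.
apply: le_trans (class_sum_le a q0 qm mn) _.
have qm' : (m.+1 - q)%N%:R = m.+1%:R - q%:R :> R by rewrite natrB//; lia.
rewrite ler_wpM2l ?invr_ge0// lerB// ler_ln ?posrE ?qm' //; lra.
Unshelve. all: by end_near. Qed.

Lemma floor_natdiv (q m : nat) (y : R) : (0 < q)%N ->
  m%:R <= y < m.+1%:R -> Num.floor (y / q%:R) = (m %/ q)%N :> int.
Proof.
move=> q0 /andP[my ym]; have qR : 0 < q%:R :> R by rewrite ltr0n.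
apply: floor_def; rewrite ler_pdivlMr// ltr_pdivrMr//; apply/andP; split.
  by apply: le_trans my; rewrite -pmulrn -natrM ler_nat leq_trunc_div.
apply: lt_le_trans ym _.
by rewrite -PoszD addn1 -pmulrn -natrM ler_nat ltn_ceil.
Qed.

Lemma divnD_count (q a m : nat) : (0 < q)%N ->
  ((a + m) %/ q = \sum_(1 <= l < m.+1 | q %| a + l) 1 + a %/ q)%N.
Proof.
move=> q0; elim: m => [|m IHm]; first by rewrite big_geq// addn0.
rewrite addnS divnS// IHm [in RHS]big_mkcond big_nat_recr //= -big_mkcond /=.
by rewrite addnS; case: (_ %| _)%N; lia.
Qed.

(** Multiples of q in (a, a + t] are counted by their offset l from a.  The
    bound N is arbitrary above t, so that the range of l can be chosen
    independently of the summation index k. *)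
Lemma floor_jump (q a N : nat) (t : R) : (0 < q)%N -> 0 <= t -> t < N.+1%:R ->
  (Num.floor ((a%:R + t) / q%:R))%:~R - (Num.floor (a%:R / q%:R : R))%:~R
  = \sum_(1 <= l < N.+1 | (q %| a + l)%N && (l%:R <= t)) 1 :> R.
Proof.
move=> q0 t0 tN.
have /andP[tm mt] := truncn_itv t0; set m := Num.truncn t in tm mt.
rewrite (@floor_natdiv q (a + m)%N)//; last first.
  by rewrite -addnS !natrD lerD2l ltrD2l tm.
rewrite (@floor_natdiv q a)//; last by rewrite lexx ltr_nat ltnSn.
rewrite -!pmulrn divnD_count// natrD addrK natr_sum.
have mN : (m.+1 <= N.+1)%N by rewrite -(ltr_nat R); apply: le_lt_trans tN.
rewrite (big_nat_widen _ _ _ _ _ mN); apply: eq_bigl => l.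
by rewrite ltnS /m truncn_ge_nat.
Qed.

(** [floor_jump] with a = k p and t = q x k / n, where N serves for all k
    because t <= q x; for fixed l, the condition l <= t is the lower bound
    k >= n / (q x / l). *)
Lemma B_diff (x : R) (p q n N : nat) : 0 <= x -> (0 < q)%N ->
  q%:R * x < N.+1%:R ->
  B n (x + p%:R / q%:R * n%:R) - B n (p%:R / q%:R * n%:R) =
  \sum_(1 <= l < N.+1) \sum_(1 <= k < n.+1 |
     (q %| k * p + l)%N && (n%:R <= q%:R * x / l%:R * k%:R)) k%:R^-1.
Proof.
move=> x0 q0 xN; have qR : 0 < q%:R :> R by rewrite ltr0n.
rewrite /B -sumrB.
under [RHS]eq_bigr do rewrite big_mkcond.
rewrite exchange_big; apply: eq_big_nat => k /andP[k0 kn] /=.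
have nR : 0 < n%:R :> R by rewrite ltr0n; lia.
have kR : 0 < k%:R :> R by rewrite ltr0n.
rewrite -mulrBr -big_mkcond /=.
set t := q%:R * x * (k%:R / n%:R).
have t0 : 0 <= t by rewrite !mulr_ge0// invr_ge0.
have -> : k%:R / n%:R * (x + p%:R / q%:R * n%:R) = ((k * p)%N%:R + t) / q%:R.
  by rewrite /t natrM; field; apply/andP; split; rewrite gt_eqF.
have -> : k%:R / n%:R * (p%:R / q%:R * n%:R) = (k * p)%N%:R / q%:R :> R.
  by rewrite natrM; field; apply/andP; split; rewrite gt_eqF.
rewrite (@floor_jump q (k * p) N t)//; last first.
  apply: le_lt_trans xN; rewrite ler_piMr ?mulr_ge0//.
  by rewrite ler_pdivrMr// mul1r ler_nat.
rewrite mulr_sumr [LHS]big_nat_cond [RHS]big_nat_cond; apply: eq_big => [l|l _].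
  apply: andb_id2l => /andP[l0 _]; congr (_ && _).
  have lR : 0 < l%:R :> R by rewrite ltr0n.
  by rewrite /t (mulrA _ k%:R) ler_pdivlMr// (mulrAC _ l%:R^-1) ler_pdivlMr// (mulrC l%:R).
by rewrite mulr1.
Qed.

End RealSums.

(** Multiplying k p + l by an inverse u of p modulo q gives k + u l modulo
    q; the Bezout relation u p = v q + 1 also shows that u is prime to q, so
    the multiplication is reversible. *)
Lemma class_of_congruence (p q l : nat) : (0 < p)%N -> coprime p q ->
  exists a, forall k, ((q %| k * p + l) = (q %| k + a))%N.
Proof.
move=> p0 cpq; case: (egcdnP q p0) => u v uv _; rewrite (eqP cpq) in uv.
have cuq : coprime q u.
  have : coprime q (v * q + 1) by rewrite /coprime gcdnMDl gcdn1.
  by rewrite -uv coprimeMr => /andP[].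
exists (u * l)%N => k.
rewrite -(Gauss_dvdr _ cuq).
have -> : (u * (k * p + l) = k * v * q + (k + u * l))%N by nia.
by rewrite dvdn_addr// dvdn_mull.
Qed.

Theorem theorem3 (R : realType) (x : R) (p q : nat)
    (hx : 0 <= x) (hp : (0 < p)%N) (hq : (0 < q)%N) (hpq : gcdn p q = 1%N) :
  (fun n : nat => B n (x + p%:R / q%:R * n%:R) - B n (p%:R / q%:R * n%:R))
    @ \oo -->
  q%:R^-1 * \sum_(1 <= k < `|Num.floor (q%:R * x)|%N.+1)
              ln (q%:R * x / k%:R).
Proof.
have qx0 : 0 <= q%:R * x by rewrite mulr_ge0.
have -> : `|Num.floor (q%:R * x)|%N = Num.truncn (q%:R * x).
  by rewrite truncn_floor qx0.
set N := Num.truncn _.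
under eq_fun do rewrite (@B_diff R x p q _ N)// ?truncnS_gt// big_nat_cond.
rewrite mulr_sumr big_nat_cond.
apply: cvg_big => [|l]; first exact: add_continuous.
rewrite andbT ltnS => /andP[l0]; rewrite truncn_ge_nat// => lx.
have [a ha] := @class_of_congruence p q l hp (introT eqP hpq).
under eq_fun do under eq_bigl do rewrite ha.
by apply: cvg_class_sum => //; rewrite ler_pdivlMr ?ltr0n// mul1r.
Qed.
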